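(* Let $X$ be a nonempty closed convex subset of a real Hilbert space $\mathcal H$, let $A:\mathcal H\to 2^{\mathcal H}$ be maximally monotone, let $B_1:\mathcal H\to\mathcal H$ be $\beta$-cocoercive for some $\beta>0$, let $B_2:\mathcal H\to\mathcal H$ be monotone and $L$-Lipschitzian for some $L>0$, and let $B_3:\mathcal H\to 2^{\mathcal H}$ be a maximally monotone operator such that $\operatorname{dom}A\cup X\subset\operatorname{dom}B_3$ and $B_3$ is single valued and continuous in $\operatorname{dom}A\cup X$. Assume that $A+B_3$ is maximally monotone and that the set of solutions to the problem $$\text{find } x\in X \text{ such that } 0\in Ax+B_1x+B_2x+B_3x \qquad (P)$$ is nonempty. Suppose that one of the following holds: (1) $X\subset\operatorname{dom}A$. (2) $\overline{\operatorname{dom}}\,A\subset\operatorname{dom}B_3$ and $B_3$ is locally bounded in $\operatorname{dom}B_3$. (3) $\overline{\operatorname{dom}}\,A\subset\operatorname{int}\operatorname{dom}B_3$. Let $\varepsilon\in\,]0,1[$, set $\rho=\min\{2\beta\varepsilon,\sqrt{1-\varepsilon}/L\}$, let $\sigma\in\,]0,1[$, let $\theta\in\,]0,\sqrt{1-\varepsilon}-L\rho\sigma[$, let $z_0\in\operatorname{dom}B_3$, and consider the sequence $(z_n)_{n\in\mathbb N}$ defined by the recurrence, for every $n\in\mathbb N$, $$x_n=J_{\gamma_nA}\big(z_n-\gamma_n(B_1+B_2+B_3)z_n\big),\qquad z_{n+1}=P_X\big(x_n+\gamma_n(B_2+B_3)z_n-\gamma_n(B_2+B_3)x_n\big),$$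 where, for every $n\in\mathbb N$, $\gamma_n$ is the largest $\gamma\in\{\rho\sigma,\rho\sigma^2,\rho\sigma^3,\dots\}$ satisfying $$\gamma\big\|B_3z_n-B_3J_{\gamma A}\big(z_n-\gamma(B_1+B_2+B_3)z_n\big)\big\|\le\theta\big\|z_n-J_{\gamma A}\big(z_n-\gamma(B_1+B_2+B_3)z_n\big)\big\|.$$ Moreover, assume that at least one of the following additional statements holds: (i) $\liminf_{n\to\infty}\gamma_n=\delta>0$. (ii) $B_3$ is uniformly continuous in any weakly compact subset of $\overline{\operatorname{conv}}(\operatorname{dom}A\cup X)$. Then $(z_n)_{n\in\mathbb N}$ converges weakly to a solution to $(P)$.
   Context: For $T:\mathcal H\to\mathcal H$ and $\beta>0$: $T$ is $\beta$-cocoercive if $\langle x-y\mid Tx-Ty\rangle\ge\beta\|Tx-Ty\|^2$ for all $x,y$; $T$ is $\beta$-Lipschitzian if $\|Tx-Ty\|\le\beta\|x-y\|$ for all $x,y$. For a set-valued operator $A:\mathcal H\to2^{\mathcal H}$, $\operatorname{dom}A=\{x: Ax\neq\varnothing\}$, $\overline{\operatorname{dom}}\,A$ is the closure of $\operatorname{dom}A$, and $J_A=(\operatorname{Id}+A)^{-1}$ is the resolvent (single valued with full domain when $A$ is maximally monotone). $A$ is locally bounded at $x$ if there is $\delta>0$ such that $A(\mathcal B(x;\delta))$ is bounded, where $\mathcal B(x;\delta)$ is the ball centered at $x$ with radius $\delta$; it is locally bounded in a nonempty set $D\subset\mathcal H$ if it is locally bounded at every $x\in D$. $P_X$ is the projection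 onto $X$, $\operatorname{int}$ denotes interior, and $\overline{\operatorname{conv}}$ denotes closed convex hull. Where $B_3$ is single valued, $B_3x$ denotes its unique value. *)

(* Defs.v *)
From HB Require Import structures.
From mathcomp Require Import all_boot all_order all_algebra.
From mathcomp Require Import all_classical all_reals all_analysis.

Set Implicit Arguments.
Unset Strict Implicit.
Unset Printing Implicit Defensive.

Import Order.TTheory GRing.Theory Num.Theory.
Import numFieldNormedType.Exports.

Local Open Scope classical_set_scope.
Local Open Scope ring_scope.

(* A real Hilbert space is a complete normed module [H] over [R : realType]
   together with an inner product [dot : {dot H for idfun}] (symmetric, bilinear,
   positive definite) that induces the norm, as expressed by [norm_of_dot]. *)
Definition norm_of_dot (R : realType) (H : completeNormedModType R)
    (dot : {dot H for idfun}) : Prop :=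
  forall x : H, `|x| ^+ 2 = dot x x.

Section Operators.
Variables (R : realType) (H : completeNormedModType R).
Implicit Types (A B : H -> set H) (f : H -> H) (D X K : set H).

Definition dom A : set H := [set x | A x !=set0].

Definition op_of f : H -> set H := fun x => [set f x].

Definition op_add A B : H -> set H :=
  fun x => [set u + v | u in A x & v in B x].

Definition op_scale (c : R) A : H -> set H := fun x => [set c *: u | u in A x].

Definition op_inv A : H -> set H := fun u => [set x | A x u].

(* The value at [w] of (Id + A)^-1; when (Id + A)^-1 w is not a singleton
   (which does not happen for a maximally monotone A) the value is arbitrary. *)
Definition resolvent A : H -> H :=
  fun w => xget 0 (op_inv (op_add (op_of id) A) w).

Definition single_valued_at A (x : H) : Prop := exists u, A x = [set u].

(* [b x] is an element of [B x] for every x in dom B, hence its unique value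
   wherever B is single valued. *)
Definition selection B (b : H -> H) : Prop := forall x, dom B x -> B x (b x).

Definition locally_bounded_at A (x : H) : Prop :=
  exists2 delta : R, 0 < delta & bounded_set (\bigcup_(y in ball x delta) A y).

Definition locally_bounded_in A D : Prop :=
  forall x, D x -> locally_bounded_at A x.

Definition unif_continuous_in f D : Prop :=
  forall e : R, 0 < e -> exists2 delta : R, 0 < delta &
    forall x y, D x -> D y -> `|x - y| < delta -> `|f x - f y| < e.

(* Metric projection; the value is arbitrary when no unique nearest point
   exists, which does not happen for X nonempty closed convex in a Hilbert space. *)
Definition metric_proj X (x : H) : H :=
  xget 0 [set p | X p /\ forall y, X y -> `|x - p| <= `|x - y|].

Definition closed_convex_hull D : set H :=
  smallest [set C : set H | closed C /\ convex_set C] D.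

End Operators.

Section InnerProduct.
Variables (R : realType) (H : completeNormedModType R).
Variable dot : {dot H for idfun}.
Implicit Types (A : H -> set H) (f : H -> H).

Definition monotone_op A : Prop :=
  forall x y u v, A x u -> A y v -> 0 <= dot (x - y) (u - v).

Definition maximally_monotone A : Prop :=
  monotone_op A /\
  forall A' : H -> set H, monotone_op A' ->
    (forall x, A x `<=` A' x) -> forall x, A' x `<=` A x.

Definition cocoercive (beta : R) f : Prop :=
  forall x y, beta * `|f x - f y| ^+ 2 <= dot (x - y) (f x - f y).

(* The topology is the coarsest one making [dot ^~ y] continuous for every y. *)
Definition weakly_compact (K : set H) : Prop :=
  compact (K : set (initial_topology (fun x : H => (dot x : {ptws H -> R})))).

Definition weakly_converges (z : nat -> H) (x : H) : Prop :=
  forall y, dot (z n) y @[n --> \oo] --> dot x y.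

End InnerProduct.

Section Problem.
Variables (R : realType) (H : completeNormedModType R).
Variables (X : set H) (A : H -> set H) (B1 B2 : H -> H).

Definition is_solution (B3 : H -> set H) (x : H) : Prop :=
  X x /\ op_add (op_add (op_add A (op_of B1)) (op_of B2)) B3 x 0.

(* In what follows [b3] is a selection of B3. *)
Variable b3 : H -> H.

Definition fb_step (g : R) (z : H) : H :=
  resolvent (op_scale g A) (z - g *: (B1 z + B2 z + b3 z)).

Definition linesearch_cond (theta : R) (z : H) (g : R) : Prop :=
  g * `|b3 z - b3 (fb_step g z)| <= theta * `|z - fb_step g z|.

Definition is_linesearch (rho sigma theta : R) (z : H) (g : R) : Prop :=
  let S := [set rho * sigma ^+ k.+1 | k in [set: nat]] in
  [/\ S g, linesearch_cond theta z g &
      forall g', S g' -> linesearch_cond theta z g' -> g' <= g].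

End Problem.

(* Main.v *)
Require Import Defs.
From HB Require Import structures.
From mathcomp Require Import all_boot all_order all_algebra.
From mathcomp Require Import all_classical all_reals all_analysis.
From mathcomp Require Import ring lra.

Set Implicit Arguments.
Unset Strict Implicit.
Unset Printing Implicit Defensive.

Import Order.TTheory GRing.Theory Num.Theory.
Import numFieldNormedType.Exports.

Local Open Scope classical_set_scope.
Local Open Scope ring_scope.

(** The convergence rests on a Fejer inequality. Put [g = gamma n], let [s] be a
solution and write [p = x n - s], [d = z n - x n]. The resolvent produces a point
of the graph of [A] above [x n]; monotonicity of [A + B3] and of [B2] compares it
with [s], and cocoercivity of [B1] absorbs the delay between evaluating [B1] at
[z n] instead of [x n]. Together with the line search, which controls the change
of [B3], and the Lipschitz bound on [B2] this gives
  [`|z n.+1 - s| ^+ 2 <= `|z n - s| ^+ 2 - c * `|z n - x n| ^+ 2]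
with [c = 1 - eps - (L * rho * sigma + theta) ^+ 2 > 0]
([half_forward_descent], [fb_step_descent]). So [z] is bounded, its distance to
every solution converges, and [z n - x n] tends to [0].

By Opial's argument ([opial]) it remains to see that weak cluster points are
solutions. They lie in [X], because closed convex sets are weakly closed. For the
inclusion it suffices to find, near [z n], points whose image under
[A + B1 + B2 + B3] contains elements of vanishing norm ([demiclosed_inclusion]).
When the step is bounded below, [x n] is such a point. Otherwise the step
[gamma n / sigma] was rejected, and the trial point [y n] of that rejected step
is used: it is close to [z n], because the displacement of a forward-backward
step grows at most linearly with the step length ([resolvent_displacement_le]),
and the failure of the test says that [`|z n - y n|] divided by the step is less
than [theta^-1 * `|b3 (z n) - b3 (y n)|], which vanishes by uniform continuity on
the weakly compact set made of the bounded part of the closed convex hull.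

The Hilbert space facts all come from one principle ([concave_maximizer]): on a
convex set of pairs [(m, c)], maximizing sequences of [c - `|m| ^+ 2] are Cauchy
by the parallelogram law. It yields metric projections, the Riesz representation
theorem and Minty's surjectivity theorem. Weak cluster points are taken along
ultrafilters: a bounded family has a weak limit along every ultrafilter, by
Riesz, which replaces the extraction of subsequences and also gives weak
compactness. *)

(** * Inner products and strongly concave maximization *)

Section HilbertSpace.
Variables (R : realType) (H : completeNormedModType R).
Variable dot : {dot H for idfun}.
Hypothesis hdot : norm_of_dot dot.

Lemma dotC x y : dot x y = dot y x.
Proof. by rewrite (hermC dot) expr0 mul1r. Qed.

Lemma dotDl x y z : dot (x + y) z = dot x z + dot y z.
Proof. exact: (linearDl dot). Qed.

Lemma dotDr x y z : dot z (x + y) = dot z x + dot z y.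
Proof. exact: (linearDr dot). Qed.

Lemma dotNl x z : dot (- x) z = - dot x z.
Proof. exact: (linearNl dot). Qed.

Lemma dotNr x z : dot z (- x) = - dot z x.
Proof. exact: (linearNr dot). Qed.

Lemma dotZl a x z : dot (a *: x) z = a * dot x z.
Proof. exact: (linearZl_LR dot). Qed.

Lemma dotZr a x z : dot z (a *: x) = a * dot z x.
Proof. exact: (linearZr_LR dot). Qed.

Lemma dot0l z : dot 0 z = 0.
Proof. exact: (linear0l dot). Qed.

Lemma dot0r z : dot z 0 = 0.
Proof. exact: (linear0r dot). Qed.

Definition dotE := (hdot, dotDl, dotDr, dotNl, dotNr, dotZl, dotZr).

Lemma cauchy_schwarz x y : `|dot x y| <= `|x| * `|y|.
Proof.
have h (t : R) : 0 <= `|x| ^+ 2 + 2 * t * dot x y + t ^+ 2 * `|y| ^+ 2.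
  have := sqr_ge0 `|x + t *: y|; rewrite !dotE (dotC y x); lra.
have [y0|y0] := eqVneq y 0.
  by rewrite y0 dot0r !normr0 mulr0.
have yp : 0 < `|y| by rewrite normr_gt0.
rewrite -(@ler_pXn2r _ 2)// ?nnegrE ?mulr_ge0// real_normK ?num_real//.
have := h (- dot x y / `|y| ^+ 2).
have -> : `|x| ^+ 2 + 2 * (- dot x y / `|y| ^+ 2) * dot x y
   + (- dot x y / `|y| ^+ 2) ^+ 2 * `|y| ^+ 2
   = ((`|x| * `|y|) ^+ 2 - dot x y ^+ 2) / `|y| ^+ 2.
  by field; rewrite gt_eqF.
by rewrite pmulr_lge0 ?invr_gt0 ?exprn_gt0// subr_ge0.
Qed.

Lemma dot_le_norm x y : dot x y <= `|x| * `|y|.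
Proof. exact: le_trans (ler_norm _) (cauchy_schwarz x y). Qed.

(** The functional [c - `|m| ^+ 2] exceeds its linear interpolation between two
points of [S] by [t * (1 - t)] times their squared distance ([gap] below). At
[t = 1/2] this makes the almost maximal points a Cauchy filter; as [t] tends to
[0], interpolating from those points towards [(m, c)] gives the first conclusion,
which is the variational inequality at the limit [x] with [G] the supremum. *)
Lemma concave_maximizer (S : H -> R -> Prop) (M : R) :
    (exists m c, S m c) ->
    (forall m c m' c' (t : R), S m c -> S m' c' -> 0 < t < 1 ->
       S (t *: m + (1 - t) *: m') (t * c + (1 - t) * c')) ->
    (forall m c, S m c -> c - `|m| ^+ 2 <= M) ->
  exists x, exists2 G, G <= M &
    (forall m c, S m c -> c - `|m| ^+ 2 + `|x - m| ^+ 2 <= G) /\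
    (forall e : R, 0 < e -> exists m c,
       [/\ S m c, `|x - m| < e & G - e < c - `|m| ^+ 2]).
Proof.
move=> [m0 [c0 S0]] Sconv Sle.
pose E := [set g | exists m c, S m c /\ g = c - `|m| ^+ 2].
have E0 : E !=set0 by exists (c0 - `|m0| ^+ 2), m0, c0.
have Eub : ubound E M by move=> _ [m [c [/Sle ? ->]]].
pose G := sup E.
have GM : G <= M by exact: ge_sup.
have gG m c : S m c -> c - `|m| ^+ 2 <= G.
  by move=> Smc; apply: ub_le_sup; [exists M|exists m, c].
have gap m c m' c' (t : R) : S m c -> S m' c' -> 0 < t < 1 ->
    t * (c - `|m| ^+ 2) + (1 - t) * (c' - `|m'| ^+ 2)
      + t * (1 - t) * `|m' - m| ^+ 2 <= G.
  move=> Sm Sm' t01; apply: le_trans (gG _ _ (Sconv _ _ _ _ _ Sm Sm' t01)).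
  by rewrite le_eqVlt; apply/orP; left; apply/eqP; rewrite !dotE (dotC m' m); ring.
pose B e := [set m | exists2 c, S m c & G - e < c - `|m| ^+ 2].
have Bmono (e e' : R) : e <= e' -> B e `<=` B e'.
  by move=> ee' m [c Sm h]; exists c => //; apply: le_lt_trans h; lra.
have Bex (e : R) : 0 < e -> B e !=set0.
  move=> e0; have hs : has_sup E by split=> //; exists M.
  by have [_ [m [c [Sm ->]]] h] := sup_adherent e0 hs; exists m, c.
pose F := filter_from [set e : R | 0 < e] B.
have FF : ProperFilter F.
  apply: filter_from_proper => //; apply: filter_from_filter.
    by exists 1; rewrite /= ltr01.
  move=> e e' /= e0 e'0; exists (Num.min e e'); rewrite /= ?lt_min ?e0//.
  by move=> m Bm; split; apply: Bmono Bm; rewrite ge_min lexx ?orbT.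
have Fcvg : cvg F.
  apply: cauchy_cvg; apply: cauchy_exP => e e0 /=.
  (* [gap] at t = 1/2 bounds the squared distance of two d-maximal points by 4d *)
  pose d := e ^+ 2 / 4; have d0 : 0 < d by rewrite divr_gt0 ?exprn_gt0.
  have [m [c Sm h]] := Bex d d0; exists m, d => //.
  move=> m' [c' Sm' h']; rewrite -ball_normE /ball_ /=.
  rewrite -(@ltr_pXn2r _ 2)// ?nnegrE ?(ltW e0)// distrC.
  have := gap _ _ _ _ (2^-1) Sm Sm'; rewrite /d in h h'.
  have -> : 0 < (2^-1 : R) < 1 by rewrite invr_gt0 ltr0n invf_lt1 ?ltr1n ?ltr0n.
  move=> /(_ isT); lra.
have [x Fx] : exists x : H, F --> x by exists (lim F).
exists x, G => //; split.
  move=> m c Sm.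
  have key (t : R) : 0 < t < 1 -> (1 - t) * `|x - m| ^+ 2 <= G - (c - `|m| ^+ 2) + t.
    move=> t01; have /andP[t0 t1] := t01.
    have cv : (fun m' => (1 - t) * `|m' - m| ^+ 2) @ F --> (1 - t) * `|x - m| ^+ 2.
      apply: cvgM; first exact: cvg_cst.
      rewrite expr2 (_ : (fun _ => _) = (fun m' => `|m' - m| * `|m' - m|)) //.
      have cn : (fun m' => `|m' - m|) @ F --> `|x - m|.
        by apply: cvg_norm; apply: cvgB; [exact: Fx|exact: cvg_cst].
      exact: cvgM.
    (* the slack t ^+ 2 is still o(t) after dividing [gap] by t *)
    apply: (cvgr_to_le cv); exists (t ^+ 2); first by rewrite /= exprn_gt0//; lra.
    move=> m' [c' Sm' h'] /=.
    have g := gap _ _ _ _ _ Sm Sm' t01.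
    have h2 : (1 - t) * (G - t ^+ 2) <= (1 - t) * (c' - `|m'| ^+ 2).
      by rewrite ler_wpM2l; lra.
    rewrite -(ler_pM2l t0); nra.
  rewrite -lerBrDl -subr_le0 leNgt; apply/negP => pos.
  set D := `|x - m| ^+ 2 in pos key *; set g := G - _ in pos key *.
  have D0 : 0 <= D by exact: sqr_ge0.
  pose t := Num.min (2^-1) ((D - g) / (2 * (1 + D))).
  have t0 : 0 < t by rewrite lt_min invr_gt0 ltr0n divr_gt0//; lra.
  have t1 : t < 1 by rewrite gt_min; apply/orP; left; rewrite invf_lt1 ?ltr1n ?ltr0n.
  have := key t; rewrite t0 t1 => /(_ isT).
  have : t <= (D - g) / (2 * (1 + D)) by rewrite ge_min lexx orbT.
  rewrite ler_pdivlMr; last lra.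
  nra.
move=> e e0.
have [e' /= e'0 hB] : F (ball x e) by apply: Fx; exact: nbhsx_ballx.
have m0' : 0 < Num.min e e' by rewrite lt_min e0.
have [m Bm] := Bex _ m0'.
have [c Sm h] : B e m by apply: Bmono Bm; rewrite ge_min lexx.
exists m, c; split=> //; rewrite -ball_normE in hB; apply: hB.
by apply: Bmono Bm; rewrite ge_min lexx orbT.
Qed.

(** * Monotone operators and resolvents *)

Section CommonPoint.
Variable P : H -> H -> Prop.

(** The convex hull of the triples [(y, v, dot y v)] over the relation [P]. Building
it inductively by binary combinations avoids families of weights. *)
Inductive fitzpatrick_hull : H -> H -> R -> Prop :=
| hull_graph y v : P y v -> fitzpatrick_hull y v (dot y v)
| hull_conv (t : R) y v c y' v' c' : 0 < t < 1 ->
    fitzpatrick_hull y v c -> fitzpatrick_hull y' v' c' ->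
    fitzpatrick_hull (t *: y + (1 - t) *: y') (t *: v + (1 - t) *: v')
      (t * c + (1 - t) * c').

Hypothesis antitone : forall y v y' v',
  P y v -> P y' v' -> dot (y - y') (v - v') <= 0.

(** Both sides are affine in each triple separately, so that the inequality extends
from the generating triples, where it is antitonicity, to the hull. *)
Lemma hull_cross y v c y' v' c' :
  fitzpatrick_hull y v c -> fitzpatrick_hull y' v' c' ->
  c + c' <= dot y v' + dot y' v.
Proof.
move=> hy hy'.
elim: hy => {y v c} [y v Pyv|t y v c z w d /andP[t0 t1] _ IHy _ IHz].
  elim: hy' => {y' v' c'} [y' v' Pyv'|t y' v' c' z' w' d' /andP[t0 t1] _ IHy _ IHz].
    by have := antitone Pyv Pyv'; rewrite !dotE; lra.
  by rewrite !dotE; nra.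
by rewrite !dotE; nra.
Qed.

(** This is the Debrunner-Flor intersection property: the condition on [x] says that
[x] lies in the ball with diameter [[y, v]], of centre [m = (y + v) / 2]. With
[c = dot y v] it reads [c - `|m| ^+ 2 + `|x - m| ^+ 2 <= 0], which is what
[concave_maximizer] gives once [c <= `|m| ^+ 2] is known on the hull; the latter
is [hull_cross] on the diagonal. *)
Lemma antitone_common_point :
  exists x, forall y v, P y v -> dot (x - y) (x - v) <= 0.
Proof.
have [[y0 [v0 P0]]|noP] := pselect (exists y v, P y v); last first.
  by exists 0 => y v Pyv; case: noP; exists y, v.
pose S m c := exists y v, fitzpatrick_hull y v c /\ m = 2^-1 *: (y + v).
have [|||x [G G0 [hG _]]] := @concave_maximizer S 0.
- by exists (2^-1 *: (y0 + v0)), (dot y0 v0), y0, v0; split=> //; constructor.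
- move=> _ c _ c' t [y [v [h ->]]] [y' [v' [h' ->]]] t01.
  exists (t *: y + (1 - t) *: y'), (t *: v + (1 - t) *: v'); split.
    exact: hull_conv.
  rewrite !scalerDr !scalerA ![_ * 2^-1]mulrC.
  by rewrite [RHS]addrACA.
- move=> _ c [y [v [h ->]]].
  have := hull_cross h h.
  by have := sqr_ge0 `|y - v|; rewrite !dotE (dotC v y); lra.
exists x => y v Pyv.
have Syv : S (2^-1 *: (y + v)) (dot y v) by exists y, v; split=> //; constructor.
have := hG _ _ Syv; rewrite !dotE (dotC v y) (dotC y x) (dotC v x); lra.
Qed.

End CommonPoint.

Lemma maximally_monotone_mem (A : H -> set H) x u : maximally_monotone dot A ->
  (forall y v, A y v -> 0 <= dot (x - y) (u - v)) -> A x u.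
Proof.
move=> [mA maxA] h.
apply: (maxA (fun y v => A y v \/ y = x /\ v = u)); last by right.
  move=> y y' v v' [Ay|[-> ->]] [Ay'|[-> ->]].
  - exact: mA.
  - by rewrite -opprB -(opprB u) dotNl dotNr opprK; apply: h.
  - exact: h.
  - by rewrite subrr dot0l.
by move=> y v Ay; left.
Qed.

(** Minty's theorem for [c *: A]: maximality turns membership of [(x, (w - x) / c)] in
the graph into a monotone relation with every point of the graph, that is, into a
common point of balls. *)
Lemma minty (A : H -> set H) (c : R) w : maximally_monotone dot A -> 0 < c ->
  exists x, A x (c^-1 *: (w - x)).
Proof.
move=> mA c0; have [mon _] := mA.
have cE : c * c^-1 = 1 by rewrite mulfV// gt_eqF.
pose P y v := A y (c^-1 *: (w - v)).
have [|x hx] := @antitone_common_point P.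
  move=> y v y' v' Pyv Pyv'.
  have := mon _ _ _ _ Pyv Pyv'; rewrite -scalerBr dotZr.
  rewrite pmulr_rge0 ?invr_gt0//.
  by rewrite !dotE; lra.
exists x; apply: maximally_monotone_mem => // y v Ayv.
have := hx y (w - c *: v).
rewrite /P subKr scalerA mulVf ?gt_eqF// scale1r => /(_ Ayv).
rewrite -(pmulr_rge0 _ c0) => h.
rewrite [X in 0 <= X](_ : _ = - dot (x - y) (x - (w - c *: v))); first lra.
by rewrite -dotZr -dotNr scalerBr scalerA cE scale1r !opprB addrAC.
Qed.

Lemma resolventP (A : H -> set H) (c : R) w : maximally_monotone dot A -> 0 < c ->
  A (resolvent (op_scale c A) w) (c^-1 *: (w - resolvent (op_scale c A) w)).
Proof.
move=> mA c0; have [x Ax] := minty w mA c0.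
rewrite /resolvent; set S := op_inv _ w.
have : S (xget 0 S).
  apply: xgetPex; exists x; exists x => //; exists (w - x); last exact: subrKC.
  by exists (c^-1 *: (w - x)) => //; rewrite scalerA mulfV ?gt_eqF// scale1r.
move: (xget 0 S) => y [_ -> [_ [u Au <-] <-]].
by rewrite addrC addKr scalerA mulVf ?gt_eqF// scale1r.
Qed.

Lemma convex_set_comb (X : set H) x y (t : R) : convex_set X -> X x -> X y ->
  0 <= t -> t <= 1 -> X (t *: x + (1 - t) *: y).
Proof.
move=> Xco Xx Xy t0 t1.
by have := Xco x y (Itv01 t0 t1); rewrite !inE => /(_ Xx Xy).
Qed.

(** Maximizing [0 - `|p - x| ^+ 2] over [p] in [X]; the variational inequality of
[concave_maximizer] at the maximizer is the obtuse angle criterion. *)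
Lemma projection_exists (X : set H) (x : H) :
  X !=set0 -> closed X -> convex_set X ->
  exists2 p, X p & forall q, X q -> dot (x - p) (q - p) <= 0.
Proof.
move=> [q0 Xq0] Xcl Xco.
pose S m (c : R) := X (m + x) /\ c = 0.
have [|||r [G G0 [hG aG]]] := @concave_maximizer S 0.
- by exists (q0 - x), 0; split=> //; rewrite subrK.
- move=> m _ m' _ t [Xm ->] [Xm' ->] /andP[t0 t1]; split; last by ring.
  have := convex_set_comb Xco Xm Xm' (ltW t0) (ltW t1); congr (X _).
  by rewrite !scalerDr addrACA -scalerDl subrKC scale1r.
- by move=> m c [_ ->]; have := sqr_ge0 `|m|; lra.
have Xp : X (r + x).
  apply: Xcl => B /nbhs_ballP[e /= e0 eB].
  have [m [c [[Xm _] h _]]] := aG e e0.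
  exists (m + x); split=> //; apply: eB; rewrite -ball_normE /ball_ /=.
  by rewrite opprD addrACA subrr addr0.
exists (r + x) => // q Xq.
have GE : G <= - `|r| ^+ 2.
  apply/ler_addgt0Pl => e e0; rewrite -lerBlDr.
  pose d := Num.min 1 (e / (2 * `|r| + 2)).
  have r2 : 0 < 2 * `|r| + 2 by have := normr_ge0 r; lra.
  have d0 : 0 < d by rewrite lt_min ltr01 divr_gt0.
  have [m [c [[_ ->] h1 h2]]] := aG d d0.
  have h3 : `|r| <= `|m| + d.
    by rewrite -lerBlDl; apply: le_trans (lerB_dist _ _) (ltW h1).
  have d1 : d <= 1 by rewrite ge_min lexx.
  have : d * (2 * `|r| + 2) <= e.
    by rewrite -ler_pdivlMr// ge_min lexx orbT.
  have : `|r| ^+ 2 - `|m| ^+ 2 <= d * (2 * `|r|).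
    have := normr_ge0 r; have := normr_ge0 m.
    by rewrite subr_sqr; case: (lerP `|r| `|m|) => *; nra.
  lra.
have Sq : S (q - x) 0 by split=> //; rewrite subrK.
have := hG _ _ Sq; rewrite !dotE in GE *.
rewrite (dotC x r) (dotC q r) (dotC q x) in GE *; lra.
Qed.

(** Maximizing [2 * l m - `|m| ^+ 2]: the variational inequality bounds the linear
form [l m - dot x m] from above on the whole space, so that it vanishes. *)
Lemma riesz (l : H -> R) (M : R) :
  (forall x y, l (x + y) = l x + l y) -> (forall a x, l (a *: x) = a * l x) ->
  (forall x, l x <= M * `|x|) -> exists x, forall y, l y = dot x y.
Proof.
move=> lD lZ lM.
pose S m (c : R) := c = 2 * l m.
have [|||x [G G0 [hG _]]] := @concave_maximizer S (M ^+ 2).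
- by exists 0, (2 * l 0).
- by move=> m _ m' _ t -> -> _; rewrite /S lD !lZ; ring.
- by move=> m _ ->; have := lM m; have := sqr_ge0 (M - `|m|); lra.
exists x.
have le y : l y <= dot x y.
  rewrite leNgt; apply/negP => h.
  (* at this multiple of [y] the upper bound [G] is exceeded by at least 1 *)
  pose a := (G + 1) / (2 * (l y - dot x y)).
  have := hG (a *: y) _ erefl.
  have : a * (2 * (l y - dot x y)) = G + 1.
    by rewrite /a mulfVK// mulf_neq0 ?subr_eq0 ?gt_eqF.
  have := sqr_ge0 `|x|; rewrite lZ !dotE (dotC y x); lra.
move=> y; apply/eqP; rewrite eq_le le/=.
by have := le (- y); rewrite dotNr -scaleN1r lZ; lra.
Qed.

(** * Weak limits along ultrafilters *)

Lemma ultra_real_limit (T : Type) (U : set_system T) (g : T -> R) (M : R) :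
  UltraFilter U -> U [set t | `|g t| <= M] -> exists l : R, g t @[t --> U] --> l.
Proof.
move=> UU Ug.
have : compact `[- M, M] by exact: segment_compact.
move=> /(_ (g @ U) _)[|l [_ gl]].
  by apply: (@filterS _ U _ _ _ _ Ug) => t; rewrite /= in_itv/= ler_norml.
exists l => B Bl.
have [//|UnB] := in_ultra_setVsetC (g @^-1` B) UU.
by have [x []] := gl (~` B) B UnB Bl.
Qed.

(** The limits of [dot (f t) y] exist by compactness of segments, and are a bounded
linear form of [y], which [riesz] represents. *)
Lemma ultra_weak_limit (T : Type) (U : set_system T) (f : T -> H) (M : R) :
  UltraFilter U -> U [set t | `|f t| <= M] ->
  exists x, forall y, dot (f t) y @[t --> U] --> dot x y.
Proof.
move=> UU Uf.
have /choice[l hl] y : exists l : R, dot (f t) y @[t --> U] --> l.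
  apply: (@ultra_real_limit _ _ _ (M * `|y|)) => //.
  apply: filterS Uf => t /= ft; apply: le_trans (cauchy_schwarz _ _) _.
  by rewrite ler_wpM2r.
have [|||x hx] := @riesz l M.
- move=> y z; apply: norm_cvg_unique (hl (y + z)) _.
  rewrite (_ : (fun t => _) = (fun t => dot (f t) y + dot (f t) z)).
    exact: cvgD.
  by apply/funext => t; rewrite dotDr.
- move=> a y; apply: norm_cvg_unique (hl (a *: y)) _.
  rewrite (_ : (fun t => _) = (fun t => a * dot (f t) y)).
    by apply: cvgM; [exact: cvg_cst|exact: hl].
  by apply/funext => t; rewrite dotZr.
- move=> y; apply: (cvgr_to_le (hl y)); apply: filterS Uf => t /= ft.
  by apply: le_trans (dot_le_norm _ _) _; rewrite ler_wpM2r.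
by exists x => y; rewrite -hx.
Qed.

(** Closed convex sets are weakly closed: the half-space that separates the weak
limit from its projection [p] contains all [f t]. *)
Lemma weak_limit_convex (T : Type) (U : set_system T) (f : T -> H) (C : set H) x :
  ProperFilter U -> closed C -> convex_set C -> U [set t | C (f t)] ->
  (forall y, dot (f t) y @[t --> U] --> dot x y) -> C x.
Proof.
move=> UU Ccl Cco UC fx.
have [t0 Ct0] := filter_ex UC.
have [p Cp hp] := @projection_exists C x (ex_intro _ (f t0) Ct0) Ccl Cco.
suff : dot (x - p) (x - p) <= 0.
  rewrite -hdot => h; have /eqP : `|x - p| ^+ 2 == 0.
    by rewrite eq_le h sqr_ge0.
  by move=> /eqP; rewrite sqrf_eq0 normr_eq0 subr_eq0 => /eqP ->.
rewrite [leLHS](_ : _ = dot x (x - p) - dot p (x - p)); last by rewrite dotDl dotNl.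
have cv : dot (f t) (x - p) - dot p (x - p) @[t --> U]
    --> dot x (x - p) - dot p (x - p).
  by apply: cvgB; [exact: fx|exact: cvg_cst].
apply: (cvgr_to_le cv); apply: filterS UC => t /= Ct.
by have := hp _ Ct; rewrite !dotE (dotC (f t) x) (dotC (f t) p) (dotC p x); lra.
Qed.

Lemma weakly_compact_convex (C : set H) (M : R) : closed C -> convex_set C ->
  weakly_compact dot (C `&` [set x | `|x| <= M]).
Proof.
move=> Ccl Cco; rewrite /weakly_compact compact_ultra => F FU FK.
have [x hx] := @ultra_weak_limit H F id M FU (filterS (@subIsetr _ _ _) FK).
exists x; split; first split.
- by apply: (@weak_limit_convex H F id) => //; exact: filterS FK.
- have hc : (fun y => dot y x) @ F --> dot x x by exact: hx.
  have : dot x x <= M * `|x|.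
    apply: (cvgr_to_le hc); apply: filterS FK => y [_ /= yM].
    by apply: le_trans (dot_le_norm _ _) _; rewrite ler_wpM2r.
  rewrite /= -hdot expr2; have [->|x0] := eqVneq x 0.
    move=> _; rewrite normr0; have [y [_ /=]] := filter_ex FK.
    exact: le_trans.
  by rewrite ler_pM2r// normr_gt0.
- have pw : (fun y => (dot y : {ptws H -> R})) @ F --> (dot x : {ptws H -> R}).
    by apply/pointwise_cvgP => y; exact: hx.
  move=> B; rewrite nbhsE => -[V [[G Gopen <-] Gx] GB].
  apply: filterS GB _; apply: pw.
  exact: open_nbhs_nbhs.
Qed.

(** * Closed convex hulls and metric projections *)

Lemma closed_closed_convex_hull (D : set H) : closed (closed_convex_hull D).
Proof. by apply: closed_bigI => C [[Ccl _] _]. Qed.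

Lemma convex_closed_convex_hull (D : set H) : convex_set (closed_convex_hull D).
Proof.
move=> x y t; rewrite !inE => hx hy C CD; have [[_ Cco] _] := CD.
have := Cco x y t; rewrite !inE; apply; [exact: hx|exact: hy].
Qed.

(** [metric_proj] is defined by minimal distance; the point with the obtuse angle
property is the only minimizer, so that it is the chosen one. *)
Lemma metric_projP (X : set H) (x : H) :
  X !=set0 -> closed X -> convex_set X ->
  X (metric_proj X x) /\
  forall q, X q -> dot (x - metric_proj X x) (q - metric_proj X x) <= 0.
Proof.
move=> X0 Xcl Xco; have [p Xp hp] := @projection_exists X x X0 Xcl Xco.
suff -> : metric_proj X x = p by [].
apply: xget_subset1.
  split=> // y Xy; have := hp _ Xy => h.
  rewrite -(@ler_pXn2r _ 2)// ?nnegrE//.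
  have -> : x - y = (x - p) - (y - p) by rewrite opprB addrA subrK.
  move: h; move: (x - p) (y - p) => u v.
  by have := sqr_ge0 `|v|; rewrite !dotE (dotC v u); lra.
move=> q r [Xq hq] [Xr hr].
suff uniq s : X s -> (forall y, X y -> `|x - s| <= `|x - y|) -> s = p.
  by rewrite (uniq q)// (uniq r).
move=> Xs hs; apply/eqP; rewrite -subr_eq0 -normr_eq0 -sqrf_eq0 eq_le sqr_ge0 andbT.
have := hs p Xp; rewrite -(@ler_pXn2r _ 2)// ?nnegrE//.
have := hp s Xs.
have -> : x - s = (x - p) - (s - p) by rewrite opprB addrA subrK.
move: (x - p) (s - p) => u v.
by rewrite !dotE (dotC v u); lra.
Qed.

Lemma metric_proj_nonexpansive (X : set H) (x s : H) :
  X !=set0 -> closed X -> convex_set X -> X s ->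
  `|metric_proj X x - s| ^+ 2 <= `|x - s| ^+ 2.
Proof.
move=> X0 Xcl Xco Xs.
have [_ /(_ _ Xs)] := @metric_projP X x X0 Xcl Xco; set p := metric_proj X x.
have -> : x - s = (x - p) - (s - p) by rewrite opprB addrA subrK.
rewrite -[`|p - s|]normrN opprB; move: (x - p) (s - p) => u v.
by have := sqr_ge0 `|u|; rewrite !dotE (dotC v u); lra.
Qed.

(** * Sums with a monotone Lipschitz operator *)

(** [C + B] is maximally monotone when [B] is monotone and Lipschitz, in the form
needed here. Testing the inequality at the resolvent point
[y = J_{tC} (x - t B x)] gives [`|x - y| ^+ 2 / t <= M * `|x - y| ^+ 2], hence
[y = x] as soon as [t < 1 / M]; the choice is [t = 1 / (M + 1)]. *)
Lemma variational_inclusion (C : H -> set H) (B : H -> H) (M : R) x :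
  maximally_monotone dot C -> 0 <= M ->
  (forall p q, `|B p - B q| <= M * `|p - q|) ->
  (forall p q, C p q -> 0 <= dot (x - p) (- B p - q)) -> C x (- B x).
Proof.
move=> mC M0 BL h.
have M1 : 0 < M + 1 by lra.
have M1i : 0 < (M + 1)^-1 by rewrite invr_gt0.
have [y] := @minty C (M + 1)^-1 (x - (M + 1)^-1 *: B x) mC M1i.
rewrite invrK => Cy; have := h _ _ Cy.
have -> : (M + 1) *: (x - (M + 1)^-1 *: B x - y) = (M + 1) *: (x - y) - B x.
  rewrite addrAC scalerBr scalerA mulfV ?scale1r//; lra.
suff -> : (- B y - ((M + 1) *: (x - y) - B x)) = (B x - B y) - (M + 1) *: (x - y).
  move=> hh.
  have xy : x = y.
    apply/eqP; rewrite -subr_eq0 -normr_eq0 -sqrf_eq0 eq_le sqr_ge0 andbT.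
    have : dot (x - y) (B x - B y) <= M * `|x - y| ^+ 2.
      apply: le_trans (dot_le_norm _ _) _; rewrite expr2 mulrCA.
      by rewrite ler_wpM2l.
    move: hh; move: (x - y) (B x - B y) => u v.
    by rewrite !dotE; lra.
  move: Cy; rewrite -xy.
  have -> // : (M + 1) *: (x - (M + 1)^-1 *: B x - x) = - B x.
  rewrite addrAC subrr sub0r scalerN scalerA mulfV ?scale1r//; lra.
by rewrite opprB addrA [- _ + _]addrC.
Qed.

(** The graph of [C + B] is closed for the weak topology on points and the norm
topology on values. The points of the graph are only assumed to exist near [f t],
for each precision [d], so that no sequence of them has to be chosen. *)
Lemma demiclosed_inclusion (T : Type) (U : set_system T) (f : T -> H)
    (C : H -> set H) (B : H -> H) (M K : R) x :
  ProperFilter U -> maximally_monotone dot C ->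
  0 <= M -> (forall p q, `|B p - B q| <= M * `|p - q|) ->
  monotone_op dot (op_of B) ->
  (forall t, `|f t| <= K) ->
  (forall y, dot (f t) y @[t --> U] --> dot x y) ->
  (forall d : R, 0 < d -> \forall t \near U, exists y e,
     [/\ C y (e - B y), `|y - f t| <= d & `|e| <= d]) ->
  C x (- B x).
Proof.
move=> UU mC M0 BL mB fK fx happ; have [mon _] := mC.
apply: (variational_inclusion mC M0 BL) => p q Cpq.
set w := - B p - q; rewrite dotDl dotNl.
have key (d : R) : 0 < d -> d <= 1 ->
    - (d * (`|w| + (K + 1 + `|p|))) <= dot x w - dot p w.
  move=> d0 d1.
  have cv : dot (f t) w - dot p w @[t --> U] --> dot x w - dot p w.
    by apply: cvgB; [exact: fx|exact: cvg_cst].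
  apply: (cvgr_to_ge cv); apply: filterS (happ d d0) => t [y [e [Cy yf ed]]].
  have h1 := mon _ _ _ _ Cy Cpq.
  have h2 := mB y p (B y) (B p) erefl erefl.
  have h3 : dot (y - f t) w <= d * `|w|.
    by apply: le_trans (dot_le_norm _ _) _; rewrite ler_wpM2r.
  have h4 : dot (y - p) e <= d * (K + 1 + `|p|).
    apply: le_trans (dot_le_norm _ _) _; rewrite mulrC.
    apply: ler_pM => //; apply: le_trans (ler_normB _ _) _; rewrite lerD2r.
    rewrite -(subrK (f t) y); apply: le_trans (ler_normD _ _) _.
    by have := fK t; lra.
  move: h1 h2 h3 h4; rewrite /w !dotE; lra.
rewrite leNgt; apply/negP => neg.
set v := dot x w - dot p w in key neg.
have K0 : 0 <= K.
  by have [t _] := filter_ex (happ 1 ltr01); apply: le_trans (fK t).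
have E0 : 0 < `|w| + (K + 1 + `|p|).
  by have := normr_ge0 w; have := normr_ge0 p; lra.
pose d := Num.min 1 (- v / (2 * (`|w| + (K + 1 + `|p|)))).
have d0 : 0 < d by rewrite lt_min ltr01 divr_gt0//; lra.
have d1 : d <= 1 by rewrite ge_min lexx.
have := key d d0 d1.
have : d <= - v / (2 * (`|w| + (K + 1 + `|p|))) by rewrite ge_min lexx orbT.
rewrite ler_pdivlMr; lra.
Qed.

(** * Estimates for the half-forward step *)

Lemma cocoercive_monotone (B : H -> H) (beta : R) : 0 < beta ->
  cocoercive dot beta B -> monotone_op dot (op_of B).
Proof.
move=> b0 cB x y _ _ -> ->; apply: le_trans (cB x y).
by rewrite mulr_ge0 ?sqr_ge0// ltW.
Qed.

Lemma cocoercive_lipschitz (B : H -> H) (beta : R) : 0 < beta ->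
  cocoercive dot beta B -> forall x y, `|B x - B y| <= beta^-1 * `|x - y|.
Proof.
move=> b0 cB x y; rewrite ler_pdivlMl//.
have := le_trans (cB x y) (dot_le_norm _ _).
have [->|n0] := eqVneq `|B x - B y| 0; first by move=> _; rewrite mulr0.
by rewrite expr2 mulrA ler_pM2r// lt_def n0/=.
Qed.

(** The estimate behind the algorithm, with [p = x - s], [d = z - x],
[D = B1 z - B1 s] and [g] the change of [B2 + b3] from [x] to [z]; the vector in
the monotonicity hypothesis is [gamma] times the difference of the elements of
the graph of [A + B2 + B3] above [x] and [s]. The loss [gamma / (2 * beta)] is the
price, by Young's inequality, of evaluating [B1] at [z]. *)
Lemma half_forward_descent (gamma beta : R) (p d D g : H) :
  0 < beta -> 0 <= gamma ->
  0 <= dot p (d - gamma *: D - gamma *: g) -> beta * `|D| ^+ 2 <= dot (p + d) D ->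
  `|p + gamma *: g| ^+ 2 <=
  `|p + d| ^+ 2 - (1 - gamma / (2 * beta)) * `|d| ^+ 2 + gamma ^+ 2 * `|g| ^+ 2.
Proof.
move=> b0 g0 hmon hco.
have young : 0 <= gamma * (2 * beta * `|D| ^+ 2 - 2 * dot d D + `|d| ^+ 2 / (2 * beta)).
  rewrite mulr_ge0//.
  have -> : 2 * beta * `|D| ^+ 2 - 2 * dot d D + `|d| ^+ 2 / (2 * beta)
      = `|(2 * beta) *: D - d| ^+ 2 / (2 * beta).
    by rewrite !dotE (dotC D d); field; rewrite gt_eqF.
  by rewrite divr_ge0 ?sqr_ge0// mulr_ge0// ltW.
have hco' : gamma * (beta * `|D| ^+ 2) <= gamma * dot (p + d) D by rewrite ler_wpM2l.
move: hmon young hco'; rewrite !dotE (dotC g p) (dotC d p).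
lra.
Qed.

(** With [p = z - x] and [q = z - y], monotonicity and Cauchy-Schwarz give
[(g' * `|p| - g * `|q|) * (`|q| - `|p|) >= 0]; the factors have opposite signs as
soon as [`|q|] exceeds [g' / g * `|p|]. *)
Lemma resolvent_displacement_le (A : H -> set H) (b z x y : H) (g g' : R) :
  monotone_op dot A -> 0 < g -> g <= g' ->
  A x (g^-1 *: (z - g *: b - x)) -> A y (g'^-1 *: (z - g' *: b - y)) ->
  `|z - y| <= g' / g * `|z - x|.
Proof.
move=> mA g0 gg' Ax Ay; have g'0 := lt_le_trans g0 gg'.
have := mA _ _ _ _ Ax Ay.
have -> : x - y = (z - y) - (z - x) by rewrite opprB [RHS]addrC addrA subrK.
have E (c : R) (u : H) : 0 < c -> c^-1 *: (z - c *: b - u) = c^-1 *: (z - u) - b.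
  by move=> c0; rewrite addrAC scalerBr scalerA mulVf ?scale1r// gt_eqF.
rewrite !E//; move: (z - y) (z - x) => q p.
rewrite opprB addrA subrK => h.
have {}h : 0 <= g * g' * dot (q - p) (g^-1 *: p - g'^-1 *: q).
  by rewrite mulr_ge0// mulr_ge0// ltW.
have h2 : 0 <= (g' + g) * (`|p| * `|q|) - g' * `|p| ^+ 2 - g * `|q| ^+ 2.
  have e : g * g' * dot (q - p) (g^-1 *: p - g'^-1 *: q)
      = (g' + g) * dot p q - g' * `|p| ^+ 2 - g * `|q| ^+ 2.
    by rewrite !dotE (dotC q p); field; rewrite !gt_eqF.
  rewrite e in h; apply: le_trans h _; rewrite lerD2r lerD2r ler_wpM2l ?dot_le_norm//.
  by lra.
rewrite mulrAC ler_pdivlMr//.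
rewrite leNgt; apply/negP => h3.
have P0 := normr_ge0 p.
have h4 : `|p| < `|q|.
  rewrite -(ltr_pM2l g0); apply: le_lt_trans (_ : g' * `|p| < _); first by rewrite ler_wpM2r.
  by rewrite [X in _ < X]mulrC.
nra.
Qed.

(** * Fejer monotone sequences and lower limits *)

Lemma fejer_sequence (u w : nat -> R) (c : R) : 0 < c ->
  (forall n, 0 <= u n) -> (forall n, 0 <= w n) ->
  (forall n, u n.+1 <= u n - c * w n) ->
  cvgn u /\ w n @[n --> \oo] --> 0.
Proof.
move=> c0 u0 w0 uw.
have cu : cvgn u.
  apply: nonincreasing_is_cvgn.
    apply/nonincreasing_seqP => n; apply: le_trans (uw n) _.
    by rewrite gerBl mulr_ge0// ltW.
  by exists 0 => _ [n _ <-].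
split=> //.
have cv : c^-1 * (u n - u n.+1) @[n --> \oo] --> c^-1 * (limn u - limn u).
  apply: cvgM; first exact: cvg_cst.
  by apply: cvgB; [exact: cu|rewrite cvg_shiftS; exact: cu].
rewrite subrr mulr0 in cv.
apply: (squeeze_cvgr _ (cvg_cst 0) cv).
by apply: nearW => n; rewrite w0/= ler_pdivlMl//; have := uw n; lra.
Qed.

(** For two weak cluster points [x] and [x'] in [S], the convergent quantity
[`|z n - x| ^+ 2 - `|z n - x'| ^+ 2] is affine in [z n], and comparing its limits
along the two ultrafilters forces [x = x']. If convergence to [x] failed on some
weak neighbourhood, an ultrafilter avoiding it would give a second one. *)
Lemma opial (z : nat -> H) (S : set H) (K : R) :
  (forall n, `|z n| <= K) ->
  (forall s, S s -> cvgn (fun n => `|z n - s| ^+ 2)) ->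
  (forall (U : set_system nat) x, ProperFilter U -> \oo `<=` U ->
     (forall y, dot (z n) y @[n --> U] --> dot x y) -> S x) ->
  exists x, S x /\ weakly_converges dot z x.
Proof.
move=> zK zcv zS.
have [U [UU oU]] := ultraFilterLemma (_ : ProperFilter \oo).
have lim (V : set_system nat) : UltraFilter V -> \oo `<=` V ->
    exists2 x, S x & forall y, dot (z n) y @[n --> V] --> dot x y.
  move=> VV oV; have [|x hx] := @ultra_weak_limit nat V z K VV.
    by apply: filterE => n; exact: zK.
  by exists x => //; apply: zS hx.
have [x Sx hx] := lim U UU oU.
exists x; split=> // y B nB.
have [//|nzB] := pselect (\oo [set n | B (dot (z n) y)]).
pose F := within [set n | ~ B (dot (z n) y)] \oo.
have PF : ProperFilter F.
  apply: Build_ProperFilter_ex => P FP.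
  apply: contrapT => nP; apply: nzB.
  have oP : \oo [set n | ~ B (dot (z n) y) -> P n] by exact: FP.
  apply: (filterS _ oP) => n hn; apply: contrapT => nBn.
  by apply: nP; exists n; exact: hn.
have [V [VV FV]] := ultraFilterLemma PF.
have oV : \oo `<=` V by move=> P oP; apply: FV; apply: filterS oP => n Pn _.
have [x' Sx' hx'] := lim V VV oV.
suff xx : x' = x.
  exfalso.
  have VB : V [set n | B (dot (z n) y)] by apply: (hx' y); rewrite xx.
  have VnB : V [set n | ~ B (dot (z n) y)] by apply: FV; exact: withinT.
  by have [n []] := filter_ex (filterI VB VnB).
have /cvg_ex[l hl] : cvgn (fun n => `|z n - x| ^+ 2 - `|z n - x'| ^+ 2).
  by apply: is_cvgB; exact: zcv.
have comp (W : set_system nat) a : ProperFilter W -> \oo `<=` W ->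
    (forall y, dot (z n) y @[n --> W] --> dot a y) ->
    l = dot x x - dot x' x' + 2 * dot a (x' - x).
  move=> WW oW ha.
  have c1 : (fun n => `|z n - x| ^+ 2 - `|z n - x'| ^+ 2) @ W --> l.
    by move=> P lP; apply: oW; exact: hl.
  apply: norm_cvg_unique c1 _.
  rewrite (_ : (fun n => _) = (fun n => dot x x - dot x' x' + 2 * dot (z n) (x' - x))).
    apply: cvgD; first exact: cvg_cst.
    by apply: cvgM; [exact: cvg_cst|exact: ha].
  by apply/funext => n; rewrite !dotE (dotC x (z n)) (dotC x' (z n)); ring.
have e1 : l = dot x x - dot x' x' + 2 * dot x (x' - x) by exact: (comp U).
have e2 : l = dot x x - dot x' x' + 2 * dot x' (x' - x) by exact: (comp V).
apply/eqP; rewrite -subr_eq0 -normr_eq0 -sqrf_eq0; apply/eqP.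
move: e2; rewrite e1 !dotE (dotC x' x); lra.
Qed.

Lemma limn_inf_near (u : nat -> R) (M a : R) : (forall n, 0 <= u n <= M) ->
  a < limn_inf u -> \forall n \near \oo, a <= u n.
Proof.
move=> uM; have ub : has_ubound (range u).
  by exists M => _ [n _ <-]; have /andP[] := uM n.
have lb : has_lbound (range u).
  by exists 0 => _ [n _ <-]; have /andP[] := uM n.
have cv := cvg_infs_sup ub lb.
rewrite /limn_inf (cvg_lim _ cv)// => au.
have ev : \forall n \near \oo, a < infs u n by exact: (cvgr_gt _ cv).
apply: filterS ev => n /ltW h; apply: le_trans h _.
by apply: ge_inf; [exact: (has_lbound_sdrop lb)|exists n => /=].
Qed.

(** * One step of the algorithm *)

Section Algorithm.
Variables (A B3 : H -> set H) (B1 B2 b3 : H -> H) (M : R).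
Hypothesis hA : maximally_monotone dot A.
Hypothesis hb3 : selection B3 b3.
Hypothesis hdom : dom A `<=` dom B3.
Hypothesis hM : forall p q, `|(B1 p + B2 p) - (B1 q + B2 q)| <= M * `|p - q|.

Lemma fb_step_graph (g : R) z : 0 < g ->
  A (fb_step A B1 B2 b3 g z)
    (g^-1 *: (z - g *: (B1 z + B2 z + b3 z) - fb_step A B1 B2 b3 g z)).
Proof. by move=> g0; apply: resolventP. Qed.

(** The point [y] solves the inclusion up to [e], which collects the scaled
displacement and the changes of the forward operators between [z] and [y]. *)
Lemma fb_step_residual (g : R) z : 0 < g ->
  let y := fb_step A B1 B2 b3 g z in
  exists e, op_add A B3 y (e - (B1 y + B2 y)) /\
    `|e| <= g^-1 * `|z - y| + M * `|z - y| + `|b3 z - b3 y|.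
Proof.
move=> g0 y; have := fb_step_graph z g0; rewrite -/y => Ay.
have By : B3 y (b3 y) by apply: hb3; apply: hdom; eexists; exact: Ay.
exists (g^-1 *: (z - y) - ((B1 z + B2 z) - (B1 y + B2 y)) - (b3 z - b3 y)); split.
  exists (g^-1 *: (z - g *: (B1 z + B2 z + b3 z) - y)) => //.
  exists (b3 y) => //.
  rewrite addrAC scalerBr scalerA mulVf ?gt_eqF// scale1r.
  move: (_ *: (z - y)) (B1 z + B2 z) (B1 y + B2 y) => a P Q.
  rewrite [RHS]addrAC; have -> : a - (P - Q) - Q = a - P.
    by rewrite opprB addrA addrAC addrK.
  by rewrite opprB opprD !addrA [RHS]addrAC.
apply: le_trans (ler_normB _ _) _; rewrite lerD2r.
apply: le_trans (ler_normB _ _) _.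
by rewrite normrZ gtr0_norm ?invr_gt0// lerD2l.
Qed.

Lemma fb_step_descent (X : set H) (beta L theta eps kappa g : R) s z x :
    monotone_op dot (op_add A B3) ->
    0 < beta -> cocoercive dot beta B1 ->
    monotone_op dot (op_of B2) -> (forall p q, `|B2 p - B2 q| <= L * `|p - q|) ->
    closed X -> convex_set X -> is_solution X A B1 B2 B3 s ->
    0 < g -> g <= 2 * beta * eps -> g * L + theta <= kappa ->
    linesearch_cond A B1 B2 b3 theta z g ->
  x = fb_step A B1 B2 b3 g z ->
  `|metric_proj X (x + g *: (B2 z + b3 z) - g *: (B2 x + b3 x)) - s| ^+ 2
  <= `|z - s| ^+ 2 - (1 - eps - kappa ^+ 2) * `|z - x| ^+ 2.
Proof.
move=> mAB b0 cB1 mB2 lB2 Xcl Xco [Xs sol] g0 gle kle ls xE.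
have := fb_step_graph z g0; rewrite -xE => Ax.
have Bx : B3 x (b3 x) by apply: hb3; apply: hdom; eexists; exact: Ax.
have X0 : X !=set0 by exists s.
apply: le_trans (metric_proj_nonexpansive _ X0 Xcl Xco Xs) _.
move: sol => [_ [_ [a As [_ -> <-]] [_ -> <-]] [v Bv sum0]].
set G := (B2 z + b3 z) - (B2 x + b3 x).
have -> : x + g *: (B2 z + b3 z) - g *: (B2 x + b3 x) - s = (x - s) + g *: G.
  by rewrite /G scalerBr addrA [LHS]addrAC [x + _ - s]addrAC.
have -> : z - s = (x - s) + (z - x) by rewrite [RHS]addrC addrA subrK.
have gG : g ^+ 2 * `|G| ^+ 2 <= kappa ^+ 2 * `|z - x| ^+ 2.
  rewrite -!exprMn.
  have : g * `|G| <= kappa * `|z - x|.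
    apply: le_trans (_ : g * (`|B2 z - B2 x| + `|b3 z - b3 x|) <= _).
      by rewrite ler_pM2l// /G opprD addrACA ler_normD.
    have h1 : g * `|B2 z - B2 x| <= g * (L * `|z - x|) by rewrite ler_pM2l.
    have h2 : (g * L + theta) * `|z - x| <= kappa * `|z - x| by rewrite ler_wpM2r.
    move: ls; rewrite /linesearch_cond -xE => ls.
    lra.
  move=> h; apply: lerXn2r; rewrite ?nnegrE//.
    by rewrite mulr_ge0// ltW.
  by apply: le_trans h; rewrite mulr_ge0// ltW.
have hgb : g / (2 * beta) * `|z - x| ^+ 2 <= eps * `|z - x| ^+ 2.
  rewrite ler_wpM2r ?sqr_ge0// ler_pdivrMr ?mulr_gt0//.
  by rewrite mulrC.
have D1 : beta * `|B1 z - B1 s| ^+ 2 <= dot (x - s + (z - x)) (B1 z - B1 s).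
  by rewrite [x - s + _]addrC addrA subrK; exact: cB1.
have D2 : 0 <= dot (x - s) (z - x - g *: (B1 z - B1 s) - g *: G).
  have h1 : 0 <= dot (x - s)
      (g^-1 *: (z - g *: (B1 z + B2 z + b3 z) - x) + b3 x - (a + v)).
    apply: mAB.
      by eexists; [exact: Ax|exists (b3 x)].
    by exists a => //; exists v.
  have h2 := mB2 x s _ _ erefl erefl.
  have h3 : 0 <= g * (dot (x - s)
      (g^-1 *: (z - g *: (B1 z + B2 z + b3 z) - x) + b3 x - (a + v))
      + dot (x - s) (B2 x - B2 s)) by rewrite mulr_ge0 ?addr_ge0// ltW.
  apply: le_trans h3 _.
  have av : a + v = - (B1 s + B2 s).
    by apply/eqP; rewrite -addr_eq0 addrAC addrA sum0.
  rewrite av /G le_eqVlt; apply/orP; left; apply/eqP.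
  by rewrite !dotE; field; rewrite gt_eqF.
have := half_forward_descent b0 (ltW g0) D2 D1.
lra.
Qed.

End Algorithm.

End HilbertSpace.

(** * Convergence of the algorithm *)

Theorem theorem3p4 (R : realType) (H : completeNormedModType R)
    (dot : {dot H for idfun}) (hdot : norm_of_dot dot)
    (X : set H) (X0 : X !=set0) (Xclosed : closed X) (Xconvex : convex_set X)
    (A : H -> set H) (hA : maximally_monotone dot A)
    (B1 : H -> H) (beta : R) (beta0 : 0 < beta) (hB1 : cocoercive dot beta B1)
    (B2 : H -> H) (hB2 : monotone_op dot (op_of B2))
    (L : R) (L0 : 0 < L) (hB2L : L.-lipschitz B2)
    (B3 : H -> set H) (hB3 : maximally_monotone dot B3)
    (hdom : dom A `|` X `<=` dom B3)
    (hB3single : forall x, (dom A `|` X) x -> single_valued_at B3 x)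
    (b3 : H -> H) (hb3 : selection B3 b3)
    (hB3cont : {within dom A `|` X, continuous b3})
    (hAB3 : maximally_monotone dot (op_add A B3))
    (hsol : exists x, is_solution X A B1 B2 B3 x)
    (hcases : [\/ X `<=` dom A,
                  closure (dom A) `<=` dom B3 /\ locally_bounded_in B3 (dom B3)
                | closure (dom A) `<=` interior (dom B3)])
    (eps : R) (heps : 0 < eps < 1)
    (rho : R) (hrho : rho = Num.min (2 * beta * eps) (Num.sqrt (1 - eps) / L))
    (sigma : R) (hsigma : 0 < sigma < 1)
    (theta : R) (htheta : 0 < theta < Num.sqrt (1 - eps) - L * rho * sigma)
    (z x : nat -> H) (gamma : nat -> R)
    (hz0 : dom B3 (z 0%N))
    (hgamma : forall n,
       is_linesearch A B1 B2 b3 rho sigma theta (z n) (gamma n))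
    (hx : forall n, x n =
       resolvent (op_scale (gamma n) A)
         (z n - gamma n *: (B1 (z n) + B2 (z n) + b3 (z n))))
    (hz : forall n, z n.+1 =
       metric_proj X (x n + gamma n *: (B2 (z n) + b3 (z n))
                   - gamma n *: (B2 (x n) + b3 (x n))))
    (hadd : (exists2 delta : R, 0 < delta & limn_inf gamma = delta) \/
            (forall K : set H, weakly_compact dot K ->
               K `<=` closed_convex_hull (dom A `|` X) ->
               unif_continuous_in b3 (K `&` [set y | single_valued_at B3 y]))) :
  exists zbar, is_solution X A B1 B2 B3 zbar /\ weakly_converges dot z zbar.
Proof.
have mon12 : monotone_op dot (op_of (fun p => B1 p + B2 p)).
  move=> p q _ _ -> ->; rewrite opprD addrACA (dotDr dot); apply: addr_ge0.
    exact: (cocoercive_monotone beta0 hB1).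
  exact: hB2.
have lB2 p q : `|B2 p - B2 q| <= L * `|p - q| by exact: (hB2L (p, q)).
pose M := beta^-1 + L.
have M0 : 0 <= M by rewrite addr_ge0 ?invr_ge0 ?ltW.
have lB p q : `|(B1 p + B2 p) - (B1 q + B2 q)| <= M * `|p - q|.
  rewrite opprD addrACA mulrDl; apply: le_trans (ler_normD _ _) _.
  by apply: lerD => //; exact: (cocoercive_lipschitz hdot beta0 hB1).
have /andP[eps0 eps1] := heps.
have /andP[sig0 sig1] := hsigma.
have /andP[th0 th1] := htheta.
have sq0 : 0 < Num.sqrt (1 - eps) by rewrite sqrtr_gt0; lra.
have rho0 : 0 < rho.
  by rewrite hrho lt_min divr_gt0// andbT !mulr_gt0.
have gam n : 0 < gamma n <= rho * sigma.
  have [[k _ <-] _ _] := hgamma n.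
  rewrite mulr_gt0 ?exprn_gt0//= ler_pM2l// exprS ler_piMr ?(ltW sig0)//.
  by rewrite exprn_ile1// ltW.
have gam0 n : 0 < gamma n by have /andP[] := gam n.
have ls n : linesearch_cond A B1 B2 b3 theta (z n) (gamma n).
  by have [_ ? _] := hgamma n.
pose kappa := L * rho * sigma + theta.
have Lrs : 0 <= L * rho * sigma by rewrite !mulr_ge0// ltW.
pose c := 1 - eps - kappa ^+ 2.
have c0 : 0 < c.
  rewrite subr_gt0 -[X in _ < X]sqr_sqrtr; last lra.
  by rewrite ltr_pXn2r ?nnegrE ?(ltW sq0) /kappa//; lra.
have xE n : x n = fb_step A B1 B2 b3 (gamma n) (z n) by exact: hx.
have hdA : dom A `<=` dom B3 by move=> p Ap; apply: hdom; left.
pose dd n := `|z n - x n|.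
have descent s : is_solution X A B1 B2 B3 s -> forall n,
    `|z n.+1 - s| ^+ 2 <= `|z n - s| ^+ 2 - c * dd n ^+ 2.
  move=> sol n; rewrite hz.
  apply: (fb_step_descent hdot hA hb3 hdA (beta := beta) (L := L) (theta := theta)) => //.
  - by have [] := hAB3.
  - have /andP[_ h] := gam n; apply: le_trans h _.
    apply: le_trans (_ : rho <= _); first by rewrite ler_piMr// ltW.
    by rewrite hrho ge_min lexx.
  - have /andP[_ h] := gam n; rewrite /kappa lerD2r mulrC -mulrA.
    by rewrite ler_pM2l.
have [s0 sol0] := hsol.
have dec s : is_solution X A B1 B2 B3 s ->
    cvgn (fun n => `|z n - s| ^+ 2) /\ (dd n ^+ 2 @[n --> \oo] --> 0).
  move=> sol; apply: (fejer_sequence c0) => [n|n|n].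
  - exact: sqr_ge0.
  - exact: sqr_ge0.
  - exact: descent.
have dd0 n : 0 <= dd n by exact: normr_ge0.
have ddlt (d : R) : 0 < d -> \forall n \near \oo, dd n < d.
  move=> d0; have [_ cv] := dec _ sol0.
  have ev : \forall n \near \oo, dd n ^+ 2 < d ^+ 2.
    by apply: (cvgr_lt _ cv); rewrite exprn_gt0.
  by apply: filterS ev => n; rewrite ltr_pXn2r ?nnegrE ?(ltW d0).
pose K := `|s0| + `|z 0%N - s0|.
have zK n : `|z n| <= K.
  have h : `|z n - s0| <= `|z 0%N - s0|.
    elim: n => // n IH; apply: le_trans IH.
    rewrite -(@ler_pXn2r _ 2)// ?nnegrE//.
    apply: le_trans (descent _ sol0 n) _.
    by rewrite gerBl mulr_ge0 ?sqr_ge0 ?ltW.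
  rewrite -(subrK s0 (z n)) addrC; apply: le_trans (ler_normD _ _) _.
  by rewrite lerD2l.
have zX n : X (z n.+1).
  by rewrite hz; exact: (proj1 (metric_projP hdot _ X0 Xclosed Xconvex)).
suff approx : forall d : R, 0 < d -> \forall n \near \oo, exists y e,
    [/\ op_add A B3 y (e - (B1 y + B2 y)), `|y - z n| <= d & `|e| <= d].
  apply: (opial hdot zK) => [s sol|U w UU oU hw].
    by have [] := dec s sol.
  split.
    apply: (weak_limit_convex hdot (U := U) (f := z)) => //.
    by apply: oU; exists 1%N => // -[|n] //= _; exact: zX.
  have [u Au [v Bv uv]] : op_add A B3 w (- (B1 w + B2 w)).
    apply: (demiclosed_inclusion hdot (U := U) (f := z)
      (B := fun p => B1 p + B2 p) (M := M) (K := K)) => //.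
    by move=> d d0; apply: oU; exact: approx.
  exists (u + B1 w + B2 w); last first.
    by exists v => //; rewrite -[u + _ + _]addrA addrAC uv addNr.
  exists (u + B1 w); last by exists (B2 w).
  by exists u => //; exists (B1 w).
(* Along steps bounded below by [g0], the accepted points [x n] are almost
   solutions: the line search bounds the change of [b3] by the displacement. *)
have accepted (g0 d : R) : 0 < g0 -> 0 < d -> \forall n \near \oo,
    g0 <= gamma n -> exists y e,
    [/\ op_add A B3 y (e - (B1 y + B2 y)), `|y - z n| <= d & `|e| <= d].
  move=> g00 d0.
  have C0 : 0 < (1 + theta) / g0 + M + 1.
    by have : 0 < (1 + theta) / g0 by [rewrite divr_gt0//; lra]; lra.
  apply: filterS (ddlt _ (divr_gt0 d0 C0)) => n; rewrite ltr_pdivlMr// => hn g0g.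
  have h0 : 0 <= (1 + theta) / g0 + M by rewrite addr_ge0// divr_ge0; lra.
  have h1 : dd n <= d by have := dd0 n; nra.
  have h2 : ((1 + theta) / g0 + M) * dd n <= d by have := dd0 n; nra.
  have [e [he1 he2]] := fb_step_residual hdot hA hb3 hdA lB (z n) (gam0 n).
  exists (x n), e; rewrite xE; split=> //; first by rewrite distrC -xE.
  apply: le_trans he2 _; rewrite -xE -/(dd n).
  have := ls n; rewrite /linesearch_cond -xE -/(dd n) => hls.
  apply: le_trans h2.
  have hb : `|b3 (z n) - b3 (x n)| <= theta * dd n / gamma n.
    by rewrite ler_pdivlMr// mulrC.
  have gi : (gamma n)^-1 <= g0^-1 by rewrite lef_pV2 ?posrE.
  have h3 : dd n / gamma n <= dd n / g0 by rewrite ler_wpM2l.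
  have h4 : theta * (dd n / gamma n) <= theta * (dd n / g0) by rewrite ler_pM2l.
  lra.
move=> d d0; case: hadd => [[delta delta0 hliminf]|huc].
  have ev : \forall n \near \oo, delta / 2 <= gamma n.
    apply: (limn_inf_near (u := gamma) (M := rho * sigma)); last by rewrite hliminf; lra.
    by move=> n; have /andP[h ->] := gam n; rewrite (ltW h).
  apply: filterS2 ev (accepted (delta / 2) d (divr_gt0 delta0 (ltr0n _ 2)) d0) => n.
  by move=> h; apply.
(* Unless [gamma n] is the largest candidate, [gamma n / sigma] is the smallest
   step that failed the test. *)
pose y n := fb_step A B1 B2 b3 (gamma n / sigma) (z n).
have gs0 n : 0 < gamma n / sigma by rewrite divr_gt0.
have yd n : `|z n - y n| <= dd n / sigma.
  have [mA _] := hA.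
  have Ax := fb_step_graph hdot B1 B2 b3 hA (z n) (gam0 n).
  have Ay := fb_step_graph hdot B1 B2 b3 hA (z n) (gs0 n).
  have gg : gamma n <= gamma n / sigma by rewrite ler_pdivlMr// ler_piMr ?ltW.
  apply: le_trans (resolvent_displacement_le hdot mA (gam0 n) gg Ax Ay) _.
  rewrite -xE -/(dd n).
  by rewrite [_ / sigma / _]mulrAC mulfV ?mul1r ?gt_eqF// mulrC.
have yA n : dom A (y n).
  by eexists; exact: (fb_step_graph hdot B1 B2 b3 hA (z n) (gs0 n)).
pose D := closed_convex_hull (dom A `|` X).
have DD : dom A `|` X `<=` D by exact: sub_gen_smallest.
have wcK : weakly_compact dot (D `&` [set p | `|p| <= K + sigma^-1]).
  apply: (weakly_compact_convex hdot).
    exact: closed_closed_convex_hull.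
  exact: convex_closed_convex_hull.
have subK : D `&` [set p | `|p| <= K + sigma^-1] `<=` D by move=> p [].
pose eta := d / (2 * (theta^-1 + 1)).
have ti0 : 0 < theta^-1 by rewrite invr_gt0.
have eta0 : 0 < eta by rewrite divr_gt0// mulr_gt0//; lra.
have [r r0 hr] := huc _ wcK subK eta eta0.
have C0 : 0 < M + 1 by lra.
(* [d1] makes the displacement contribute at most [d / 2] to the residual, [eta]
   bounds the rest by [d / 2]; the bound 1 keeps [y n] in the weakly compact set. *)
pose d1 := Num.min 1 (Num.min r (Num.min d (d / (2 * (M + 1))))).
have d10 : 0 < d1 by rewrite !lt_min ltr01 r0 d0 divr_gt0// mulr_gt0.
have d1r : d1 <= r by rewrite /d1 !ge_min lexx !orbT.
have d1d : d1 <= d by rewrite /d1 !ge_min lexx !orbT.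
have d1M : d1 * (2 * (M + 1)) <= d.
  by rewrite -ler_pdivlMr ?mulr_gt0// /d1 !ge_min lexx !orbT.
have d11 : d1 <= 1 by rewrite /d1 !ge_min lexx.
have ev1 := ddlt _ (mulr_gt0 d10 sig0).
have rs0 : 0 < rho * sigma by rewrite mulr_gt0.
(* [z 0] need not lie in [X], where [b3] is controlled; later iterates do. *)
have ev2 : \forall n \near \oo, (0 < n)%N by exists 1%N.
apply: filterS3 ev1 ev2 (accepted _ d rs0 d0) => n hn n0 hacc.
have [[k _ gE] _ gmax] := hgamma n.
(* For [k = 0] no step was rejected, but then [gamma n] is [rho * sigma]. *)
case: k gE => [|k] gE; first by apply: hacc; rewrite -gE expr1.
have gsE : gamma n / sigma = rho * sigma ^+ k.+1.
  by rewrite -gE exprS [sigma * _]mulrC mulrA mulfK ?gt_eqF.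
have reject : ~ linesearch_cond A B1 B2 b3 theta (z n) (gamma n / sigma).
  move=> acc; have : gamma n / sigma <= gamma n.
    by apply: gmax => //; exists k => //; rewrite gsE.
  by rewrite ler_pdivrMr// ler_pMr// leNgt sig1.
have zy : `|z n - y n| < d1.
  by apply: le_lt_trans (yd n) _; rewrite ltr_pdivrMr.
have [e [he1 he2]] := fb_step_residual hdot hA hb3 hdA lB (z n) (gs0 n).
exists (y n), e; split=> //; first by rewrite distrC (le_trans (ltW zy)).
apply: le_trans he2 _; rewrite -/(y n).
move: reject => /negP; rewrite -ltNge -/(y n) => reject.
have zD : X (z n) by case: (n) n0 => // m _; exact: zX.
have bb : `|b3 (z n) - b3 (y n)| < eta.
  apply: hr; last exact: lt_le_trans zy d1r.
  - split; last by apply: hB3single; right.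
    split; first by apply: DD; right.
    by apply: le_trans (zK n) _; rewrite lerDl invr_ge0 ltW.
  - split; last by apply: hB3single; left; exact: yA.
    split; first by apply: DD; left; exact: yA.
    rewrite /= -(subrKC (z n) (y n)); apply: le_trans (ler_normD _ _) _.
    apply: lerD => //; rewrite distrC; apply: le_trans (ltW zy) _.
    by apply: le_trans d11 _; rewrite invf_ge1// ltW.
have h1 : (gamma n / sigma)^-1 * `|z n - y n| <= theta^-1 * `|b3 (z n) - b3 (y n)|.
  by rewrite ler_pdivrMl// mulrCA ler_pdivlMl// ltW.
have h2 : theta^-1 * `|b3 (z n) - b3 (y n)| <= theta^-1 * eta.
  by rewrite ler_pM2l// ltW.
have h3 : M * `|z n - y n| <= M * d1 by rewrite ler_wpM2l// ltW.
have h4 : eta * (2 * (theta^-1 + 1)) = d by rewrite /eta mulfVK// gt_eqF// mulr_gt0//; lra.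
lra.
Qed.
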